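(* Let $k$ be a commutative ring. For every Lie triple system $T$ over $k$, the canonical inclusion map $\iota_T:T\to\mathfrak A(T)=\langle T,T\rangle\oplus T$ is a universal imbedding of $T$.
   Context: A Lie triple system over a commutative ring $k$ is a $k$-module $T$ with a $k$-trilinear map $[\ ,\ ,\ ]:T\times T\times T\to T$ such that for all $a,b,c,d,e\in T$: $[a,a,b]=0$; $[a,b,c]+[b,c,a]+[c,a,b]=0$; $[a,b,[c,d,e]]=[[a,b,c],d,e]+[c,[a,b,d],e]+[c,d,[a,b,e]]$. Homomorphisms are $k$-linear maps preserving the triple product. Every Lie algebra $L$ over $k$ is a Lie triple system under $[a,b,c]=[[a,b],c]$. An imbedding of $T$ into a Lie algebra $L$ is a $k$-linear map $\varepsilon:T\to L$ with $\varepsilon([a,b,c])=[[\varepsilon(a),\varepsilon(b)],\varepsilon(c)]$ (injectivity is not required). An imbedding $\nu:T\to U$ into a Lie algebra $U$ is universal if for every Lie algebra $L$ over $k$ and every imbedding $\varepsilon:T\to L$ there is a unique Lie algebra homomorphism $\varphi:U\to L$ with $\varphi\circ\nu=\varepsilon$. Construction of $\mathfrak A(T)$: for $a,b\in T$ let $D_{a,b}\in\mathrm{End}_k(T)$, $D_{a,b}c=[a,b,c]$. Let $D_{a,b}$ act on the exterior square $T\wedge T$ over $k$ by $D_{a,b}\cdot(c\wedge d)=D_{a,b}c\wedge d+c\wedge D_{a,b}d$. Let $\lambda:T\wedge T\to\mathrm{End}_k(T)$ be the linear map with $\lambda(a\wedge b)=D_{a,b}$, let $A(T\wedge T)=\mathrm{span}_k\{\lambda(x)\cdot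 x:x\in T\wedge T\}$, let $\langle T,T\rangle=(T\wedge T)/A(T\wedge T)$ and let $\langle a,b\rangle$ be the coset of $a\wedge b$. Then $\langle T,T\rangle$ is a Lie algebra under $[\langle a,b\rangle,\langle c,d\rangle]=\langle D_{a,b}c,d\rangle+\langle c,D_{a,b}d\rangle$, and $\mu(\langle a,b\rangle)=D_{a,b}$ defines a Lie algebra homomorphism $\mu:\langle T,T\rangle\to\mathrm{End}_k(T)$. The Lie algebra $\mathfrak A(T)$ is the $k$-module $\langle T,T\rangle\oplus T$ with product $[X+a,Y+b]=([X,Y]+\langle a,b\rangle)+(\mu(X)b-\mu(Y)a)$ for $X,Y\in\langle T,T\rangle$, $a,b\in T$. *)

(* Defs.v *)
From HB Require Import structures.
From mathcomp Require Import all_boot all_algebra all_classical.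

Set Implicit Arguments.
Unset Strict Implicit.
Unset Printing Implicit Defensive.

Import GRing.Theory.
Local Open Scope ring_scope.
Local Open Scope classical_set_scope.
Local Open Scope quotient_scope.

(* [comPzRingType]: commutative rings with 1, the zero ring included. *)

HB.mixin Record isLieAlgebra (k : comPzRingType) L of GRing.Lmodule k L := {
  lie : L -> L -> L;
  lie_linearl : forall y, linear (lie^~ y);
  lie_linearr : forall x, linear (lie x);
  liexx : forall x, lie x x = 0;
  lie_jacobi : forall x y z,
    lie x (lie y z) + lie y (lie z x) + lie z (lie x y) = 0
}.

#[short(type="lieAlgType")]
HB.structure Definition LieAlgebra (k : comPzRingType) :=
  {L of GRing.Lmodule k L & isLieAlgebra k L}.

Notation "[ 'lie' x , y ]" := (lie x y) (format "[ 'lie'  x ,  y ]").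

HB.mixin Record isLieTriple (k : comPzRingType) T of GRing.Lmodule k T := {
  lts : T -> T -> T -> T;
  lts_linear1 : forall b c, linear (fun a => lts a b c);
  lts_linear2 : forall a c, linear (fun b => lts a b c);
  lts_linear3 : forall a b, linear (lts a b);
  ltsxx : forall a b, lts a a b = 0;
  lts_cyclic : forall a b c, lts a b c + lts b c a + lts c a b = 0;
  lts_der : forall a b c d e,
    lts a b (lts c d e)
    = lts (lts a b c) d e + lts c (lts a b d) e + lts c d (lts a b e)
}.

#[short(type="lieTripleType")]
HB.structure Definition LieTriple (k : comPzRingType) :=
  {T of GRing.Lmodule k T & isLieTriple k T}.

Notation "[ 'lts' a , b , c ]" := (lts a b c) (format "[ 'lts'  a ,  b ,  c ]").

HB.instance Definition _ (k : comPzRingType) (L : lieAlgType k) (x : L) :=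
  GRing.isLinear.Build k L L *:%R (lie x) (lie_linearr x).

HB.instance Definition _ (k : comPzRingType) (T : lieTripleType k) (a b : T) :=
  GRing.isLinear.Build k T T *:%R (lts a b) (lts_linear3 a b).

Definition lie_hom (k : comPzRingType) (U L : lieAlgType k) (f : U -> L) : Prop :=
  linear f /\ {morph f : x y / [lie x, y]}.

Definition imbedding (k : comPzRingType) (T : lieTripleType k) (L : lieAlgType k)
    (e : T -> L) : Prop :=
  linear e /\ forall a b c, e [lts a, b, c] = [lie [lie e a, e b], e c].

Definition universal_imbedding (k : comPzRingType) (T : lieTripleType k)
    (U : lieAlgType k) (nu : T -> U) : Prop :=
  imbedding nu /\
  forall (L : lieAlgType k) (e : T -> L), imbedding e ->
    exists! phi : U -> L, lie_hom phi /\ phi \o nu = e.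

Section Span.
Variables (k : pzRingType) (V : lmodType k).
Implicit Types (X : set V) (u v : V).

Definition submodule : set (set V) :=
  [set M | M 0 /\ forall c u v, M u -> M v -> M (c *: u + v)].

Definition lspan X : {pred V} := fun v => `[< smallest submodule X v >].

Lemma lspanP X v :
  reflect (forall M, submodule M -> X `<=` M -> M v) (v \in lspan X).
Proof.
apply: (iffP (asboolP _)) => [h M sM XM|h M [sM XM]]; first exact: h.
exact: h.
Qed.

Lemma lspan_closed X : submod_closed (lspan X).
Proof.
split=> [|c u v /lspanP hu /lspanP hv]; apply/lspanP => M sM XM.
  by case: sM.
by apply: sM.2; [exact: hu|exact: hv].
Qed.

HB.instance Definition _ X := GRing.isSubmodClosed.Build k V (lspan X)
  (lspan_closed X).

Lemma mem_lspan X v : X v -> v \in lspan X.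
Proof. by move=> Xv; apply/lspanP => M _; apply. Qed.

End Span.

Section QuotientModule.
Variables (k : pzRingType) (V : lmodType k) (X : set V).
Implicit Types u v : V.

Definition modquot : Type := {ideal_quot lspan X}.
Implicit Types p q : modquot.
HB.instance Definition _ := GRing.Zmodule.on modquot.
HB.instance Definition _ := Quotient.on modquot.

Lemma modquot_eqP u v :
  reflect (\pi_modquot u = \pi_modquot v) (u - v \in lspan X).
Proof. by rewrite (Quotient.idealrBE (lspan X)); exact: eqP. Qed.

Definition modquot_scale c (q : modquot) : modquot := \pi_modquot (c *: repr q).

Lemma pi_modquotZ c v : \pi_modquot (c *: v) = modquot_scale c (\pi_modquot v).
Proof.
by apply/modquot_eqP; rewrite -scalerBr rpredZ//; apply/modquot_eqP; rewrite reprK.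
Qed.

Lemma pi_modquotD u v :
  \pi_modquot (u + v) = \pi_modquot u + \pi_modquot v.
Proof. exact: (@Quotient.pi_add _ (lspan X)). Qed.

Fact modquot_scaleA c d q :
  modquot_scale c (modquot_scale d q) = modquot_scale (c * d) q.
Proof. by rewrite -[q]reprK -(pi_modquotZ d) -!pi_modquotZ scalerA. Qed.

Fact modquot_scale1 : left_id 1 modquot_scale.
Proof. by move=> q; rewrite -[q]reprK -!pi_modquotZ scale1r. Qed.

Fact modquot_scaleDr : right_distributive modquot_scale +%R.
Proof.
move=> c p q.
by rewrite -[p]reprK -[q]reprK -pi_modquotD -!pi_modquotZ -pi_modquotD scalerDr.
Qed.

Fact modquot_scaleDl q : {morph modquot_scale^~ q : c d / c + d}.
Proof.
by move=> c d; rewrite -[q]reprK -!pi_modquotZ -pi_modquotD scalerDl.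
Qed.

HB.instance Definition _ := GRing.Zmodule_isLmodule.Build k modquot
  modquot_scaleA modquot_scale1 modquot_scaleDr modquot_scaleDl.

Definition modcoset v : modquot := \pi_modquot v.

Fact modcoset_linear : linear modcoset.
Proof. by move=> c u v; rewrite /modcoset pi_modquotD pi_modquotZ. Qed.
HB.instance Definition _ := GRing.isLinear.Build k V modquot *:%R modcoset modcoset_linear.

Lemma modcoset_eqP u v : reflect (modcoset u = modcoset v) (u - v \in lspan X).
Proof. exact: modquot_eqP. Qed.

Lemma modcosetK : cancel (repr : modquot -> V) modcoset.
Proof. exact: reprK. Qed.

Lemma modcoset0 v : X v -> modcoset v = 0.
Proof.
by move=> Xv; rewrite -(linear0 modcoset); apply/modcoset_eqP; rewrite subr0 mem_lspan.
Qed.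

#[global] Opaque modquot_scale modcoset.

Lemma lspan_ker (W : lmodType k) (f : V -> W) : linear f ->
  (forall v, X v -> f v = 0) -> forall v, v \in lspan X -> f v = 0.
Proof.
move=> fl Xf v /lspanP/(_ [set w | f w = 0]); apply; last by move=> w /Xf.
split=> /= [|c x y fx fy]; last by rewrite fl fx fy scaler0 addr0.
by rewrite -{1}(addr0 0) -{1}(oppr0) -scaleN1r fl scaleN1r addNr.
Qed.

End QuotientModule.

Section FreeModule.
Variables (k : pzRingType) (G : choiceType).
Implicit Types (g h : G) (f : G -> k^o).

Definition finsupp : {pred (G -> k^o)} :=
  fun f => `[< finite_set [set g | f g != 0] >].

Fact finsupp_closed : submod_closed finsupp.
Proof.
split=> [|c f1 f2 /asboolP f1P /asboolP f2P]; apply/asboolP.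
  by rewrite (_ : mkset _ = set0) // -subset0 => g /=; rewrite eqxx.
apply: (@sub_finite_set _ _ ([set g | f1 g != 0] `|` [set g | f2 g != 0])).
  move=> g /=; apply: contra_neqP => /not_orP[/negP/negPn/eqP f10 /negP/negPn/eqP f20].
  rewrite (_ : _ g = c * f1 g + f2 g) // f10 f20 mulr0; exact: addr0.
by rewrite finite_setU.
Qed.
HB.instance Definition _ :=
  GRing.isSubmodClosed.Build k (G -> k^o) finsupp finsupp_closed.

Record freemod := Freemod { freemod_fun : G -> k^o ; _ : freemod_fun \in finsupp }.
HB.instance Definition _ := [isSub for freemod_fun].
HB.instance Definition _ := [Choice of freemod by <:].
HB.instance Definition _ := [SubChoice_isSubLmodule of freemod by <:].

Definition coef (m : freemod) g : k := freemod_fun m g.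
Arguments coef : simpl never.

Fact freegen_subproof g : (fun h => (h == g)%:R) \in finsupp.
Proof.
apply/asboolP; apply: (@sub_finite_set _ _ [set g]) => // h /=.
by case: (h =P g) => //; rewrite eqxx.
Qed.
Definition freegen g : freemod := Freemod (freegen_subproof g).

Fact freegen_finsupp (m : freemod) : finite_set [set g | coef m g != 0].
Proof. by have /asboolP := valP m. Qed.

Lemma coefP c (m n : freemod) g : coef (c *: m + n) g = c * coef m g + coef n g.
Proof. by []. Qed.

Lemma coef_gen g h : coef (freegen g) h = (h == g)%:R.
Proof. by []. Qed.

Lemma coef_sum_gen (s : seq G) (a : G -> k) h :
  coef (\sum_(g <- s) a g *: freegen g) h = \sum_(g <- s) a g * (h == g)%:R.
Proof.
elim: s => [|g s IHs]; first by rewrite !big_nil.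
by rewrite !big_cons coefP IHs.
Qed.

Lemma freemod_ind (P : set freemod) : submodule P ->
  (forall g, P (freegen g)) -> forall m, P m.
Proof.
move=> [P0 PD] Pgen m.
have /finite_seqP[s' s'P] := freegen_finsupp m.
pose s := undup s'; have us : uniq s by exact: undup_uniq.
have sP g : (g \in s) = (coef m g != 0).
  have e : (coef m g != 0 : Prop) = (g \in s') := f_equal (@^~ g) s'P.
  by rewrite mem_undup; apply/idP/idP; rewrite e.
have -> : m = \sum_(g <- s) coef m g *: freegen g.
  apply: val_inj; apply/funext => h.
  rewrite -[LHS]/(coef m h) -[RHS]/(coef _ h) coef_sum_gen.
  have [mh0|mh0] := eqVneq (coef m h) 0.
    rewrite mh0 big1_seq // => g _.
    by have [<-|] := eqVneq h g; rewrite ?mh0 ?mul0r ?mulr0.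
  rewrite (big_rem h) /= ?sP // eqxx mulr1.
  rewrite big1_seq; first exact/esym/addr0.
  move=> g /andP[_]; rewrite mem_rem_uniq // => /andP[/= gh _].
  by rewrite eq_sym (negPf gh) mulr0.
elim: s {us sP} => [|g s IHs]; first by rewrite big_nil.
by rewrite big_cons; exact: PD.
Qed.

Section Lift.
Variables (M : lmodType k) (F : G -> M).

Definition freelift (m : freemod) : M := \sum_(g \in [set: G]) coef m g *: F g.

Lemma freelift_widen (A : set G) m : finite_set A ->
  [set g | coef m g != 0] `<=` A ->
  freelift m = \sum_(g \in A) coef m g *: F g.
Proof.
move=> finA sA; apply/esym/fsbig_widen => // g [_ /= nAg].
have [/= mg0|/sA//] := eqVneq (coef m g) 0.
by rewrite mg0 scale0r.
Qed.

Fact freelift_linear : linear freelift.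
Proof.
move=> c m n.
set A := [set g | coef m g != 0] `|` [set g | coef n g != 0].
have finA : finite_set A by rewrite finite_setU; split; exact: freegen_finsupp.
rewrite !(@freelift_widen A)//; first last.
- move=> g /=; apply: contra_neqP.
  move=> /not_orP[/negP/negPn/eqP mg0 /negP/negPn/eqP ng0].
  by rewrite coefP mg0 ng0 mulr0; exact: addr0.
- by move=> g mg; left.
- by move=> g ng; right.
rewrite !fsbig_finite//= scaler_sumr -big_split/=.
by apply: eq_bigr => g _; rewrite coefP scalerDl scalerA.
Qed.
HB.instance Definition _ :=
  GRing.isLinear.Build k freemod M *:%R freelift freelift_linear.

Lemma freelift_gen g : freelift (freegen g) = F g.
Proof.
rewrite (@freelift_widen [set g])//; first last.
  by move=> h /=; rewrite coef_gen; case: (h =P g) => //; rewrite eqxx.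
by rewrite fsbig_set1 coef_gen eqxx scale1r.
Qed.

End Lift.
#[global] Opaque freelift.
End FreeModule.

Section ExteriorSquare.
Variables (k : comPzRingType) (T : lmodType k).
Implicit Types a b c d : T.

Inductive wedge_rel : set (freemod k (T * T)%type) :=
| WedgeLinl r a a' b : wedge_rel
    (freegen k (r *: a + a', b) - (r *: freegen k (a, b) + freegen k (a', b)))
| WedgeLinr r a b b' : wedge_rel
    (freegen k (a, r *: b + b') - (r *: freegen k (a, b) + freegen k (a, b')))
| WedgeAlt a : wedge_rel (freegen k (a, a)).

Definition extsq : Type := modquot wedge_rel.
HB.instance Definition _ := GRing.Lmodule.on extsq.

Definition wedge a b : extsq := modcoset wedge_rel (freegen k (a, b)).

Lemma wedge_linearl b : linear (wedge^~ b).
Proof.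
move=> r a a'; apply/eqP; rewrite -subr_eq0.
by have := modcoset0 (WedgeLinl r a a' b); rewrite linearB linearP => /eqP.
Qed.

Lemma wedge_linearr a : linear (wedge a).
Proof.
move=> r b b'; apply/eqP; rewrite -subr_eq0.
by have := modcoset0 (WedgeLinr r a b b'); rewrite linearB linearP => /eqP.
Qed.

Lemma wedgexx a : wedge a a = 0.
Proof. by apply: modcoset0; exact: WedgeAlt. Qed.

HB.instance Definition _ a :=
  GRing.isLinear.Build k T extsq *:%R (wedge a) (wedge_linearr a).

#[global] Opaque wedge.

Lemma wedgeDl a a' b : wedge (a + a') b = wedge a b + wedge a' b.
Proof. by have := wedge_linearl b 1 a a'; rewrite !scale1r. Qed.

Lemma wedgeBl a a' b : wedge (a - a') b = wedge a b - wedge a' b.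
Proof.
by rewrite addrC -scaleN1r wedge_linearl scaleN1r addrC.
Qed.

Lemma wedgeBr a b b' : wedge a (b - b') = wedge a b - wedge a b'.
Proof. exact: linearB. Qed.

Lemma wedgeC a b : wedge b a = - wedge a b.
Proof.
apply/eqP; rewrite -subr_eq0 opprK addrC; apply/eqP.
by have := wedgexx (a + b); rewrite wedgeDl !linearD /= !wedgexx add0r addr0.
Qed.

Lemma extsq_ind (P : extsq -> Prop) :
  P 0 -> (forall r x y, P x -> P y -> P (r *: x + y)) ->
  (forall a b, P (wedge a b)) -> forall x, P x.
Proof.
move=> P0 PD Pw x; rewrite -[x]modcosetK; move: (repr x) => m.
apply: (@freemod_ind _ _ (fun m => P (modcoset wedge_rel m))); last first.
  by move=> [a b]; exact: Pw.
split=> [|r u v Pu Pv] /=; first by rewrite linear0.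
by rewrite linearP; exact: PD.
Qed.

Section Lift.
Variable M : lmodType k.
Implicit Type f : T -> T -> M.

Definition alternating f : Prop :=
  [/\ forall b, linear (f^~ b), forall a, linear (f a) & forall a, f a a = 0].

(* the linear map with [a /\ b |-> f a b], for [f] bilinear and alternating *)
Definition ext_lift f (x : extsq) : M :=
  freelift (fun ab => f ab.1 ab.2) (repr x).

Lemma ext_lift_coset f m : alternating f ->
  ext_lift f (modcoset wedge_rel m) = freelift (fun ab => f ab.1 ab.2) m.
Proof.
move=> [fl fr fxx]; apply/eqP; rewrite -subr_eq0 -linearB; apply/eqP.
apply: (@lspan_ker _ _ wedge_rel); first exact: linearP; last first.
  by apply/modcoset_eqP; rewrite modcosetK.
move=> _ [r a a' b|r a b b'|a]; rewrite ?linearB ?linearP /= !freelift_gen /=.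
- by rewrite fl scalerN -opprD subrr.
- by rewrite fr scalerN -opprD subrr.
- exact: fxx.
Qed.

Lemma ext_liftE f a b : alternating f -> ext_lift f (wedge a b) = f a b.
Proof. by move=> falt; rewrite ext_lift_coset // freelift_gen. Qed.

Lemma ext_lift_linear f : alternating f -> linear (ext_lift f).
Proof.
move=> falt r x y; rewrite -[x]modcosetK -[y]modcosetK -linearP.
by rewrite !ext_lift_coset // linearP.
Qed.

End Lift.
#[global] Opaque ext_lift.

(* action of an endomorphism [g] of [T] as a derivation *)
Definition derext (g : T -> T) : extsq -> extsq :=
  ext_lift (fun c d => wedge (g c) d + wedge c (g d)).

Lemma derext_alternating (g : {linear T -> T}) :
  alternating (fun c d => wedge (g c) d + wedge c (g d)).
Proof.
split=> [b r a a'|a r b b'|a].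
- by rewrite linearP !wedge_linearl scalerDr addrACA.
- by rewrite linearP !wedge_linearr scalerDr addrACA.
- by rewrite wedgeC addNr.
Qed.

Lemma derextE (g : {linear T -> T}) c d :
  derext g (wedge c d) = wedge (g c) d + wedge c (g d).
Proof. exact/ext_liftE/derext_alternating. Qed.

HB.instance Definition _ (g : {linear T -> T}) :=
  GRing.isLinear.Build k extsq extsq *:%R (derext g)
    (ext_lift_linear (derext_alternating g)).

#[global] Opaque derext.

End ExteriorSquare.

Section Standard.
Variables (k : comPzRingType) (T : lieTripleType k).
Implicit Types (a b c d e : T) (x y z : extsq T).

Lemma lts_alternating : alternating (fun a b => lts a b : T -> T).
Proof.
split=> [b r a a'|a r b b'|a]; apply/funext => c.
- exact: lts_linear1.
- exact: lts_linear2.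
- exact: ltsxx.
Qed.

(* the linear map T /\ T -> End(T) with [a /\ b |-> D_(a, b)] *)
Definition lam : extsq T -> T -> T := ext_lift (fun a b => lts a b : T -> T).

Lemma lamE a b : lam (wedge a b) = lts a b.
Proof. exact/ext_liftE/lts_alternating. Qed.

Lemma lamP r x y a : lam (r *: x + y) a = r *: lam x a + lam y a.
Proof. by rewrite /lam (ext_lift_linear lts_alternating). Qed.

Lemma lamD x y a : lam (x + y) a = lam x a + lam y a.
Proof. by have := lamP 1 x y a; rewrite !scale1r. Qed.

Lemma lam0 a : lam 0 a = 0.
Proof. by have := lamP (-1) 0 0 a; rewrite !scaleN1r oppr0 addr0 addNr. Qed.

#[global] Opaque lam.

Fact lam_linear x : linear (lam x).
Proof.
elim/extsq_ind: x => [|r x y xl yl|a b]; last by rewrite lamE; exact: lts_linear3.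
  by move=> r a b; rewrite !lam0 scaler0 addr0.
by move=> s a b; rewrite !lamP xl yl !scalerDr !scalerA [r * s]mulrC addrACA.
Qed.
HB.instance Definition _ x :=
  GRing.isLinear.Build k T T *:%R (lam x) (lam_linear x).

Lemma lts_linear1D c d a a' : lts (a + a') c d = lts a c d + lts a' c d.
Proof. by have := lts_linear1 c d 1 a a'; rewrite !scale1r. Qed.

Lemma lts0l a b : lts 0 a b = 0.
Proof.
by have := lts_linear1 a b (-1) 0 0; rewrite !scaleN1r oppr0 addr0 addNr.
Qed.

Lemma lts0m a b : lts a 0 b = 0.
Proof.
by have := lts_linear2 a b (-1) 0 0; rewrite !scaleN1r oppr0 addr0 addNr.
Qed.

Lemma lts_linear2D c d a a' : lts c (a + a') d = lts c a d + lts c a' d.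
Proof. by have := lts_linear2 c d 1 a a'; rewrite !scale1r. Qed.

Lemma ltsC a b c : lts b a c = - lts a b c.
Proof.
apply/eqP; rewrite -subr_eq0 opprK addrC; apply/eqP.
have := ltsxx (a + b) c.
by rewrite lts_linear1D !lts_linear2D !ltsxx add0r addr0.
Qed.

Lemma lam_der x c d e : lam x (lts c d e)
  = lts (lam x c) d e + lts c (lam x d) e + lts c d (lam x e).
Proof.
elim/extsq_ind: x => [|r x y xD yD|a b]; last by rewrite lamE; exact: lts_der.
  by rewrite !lam0 linear0 lts0l lts0m !addr0.
by rewrite !lamP xD yD lts_linear1 lts_linear2 linearP
   !scalerDr [LHS]addrACA (addrACA (r *: _)).
Qed.

(* The product lambda(x) . y on T /\ T; it is a left Leibniz product *)
Local Notation "x @@ y" := (derext (lam x) y) (at level 40, left associativity).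

Lemma leibPr r x y z : x @@ (r *: y + z) = r *: (x @@ y) + x @@ z.
Proof. exact: linearP. Qed.

Lemma leib0r x : x @@ 0 = 0.
Proof. exact: linear0. Qed.

Lemma leibDr x y z : x @@ (y + z) = x @@ y + x @@ z.
Proof. exact: linearD. Qed.

Lemma leibPl r x x' y : (r *: x + x') @@ y = r *: (x @@ y) + x' @@ y.
Proof.
elim/extsq_ind: y => [|s y y' yl yl'|c d].
- by rewrite !leib0r scaler0 addr0.
- by rewrite !leibPr yl yl' !scalerDr !scalerA [r * s]mulrC addrACA.
- by rewrite !derextE /= !lamP wedge_linearl wedge_linearr scalerDr addrACA.
Qed.

Lemma leibDl x x' y : (x + x') @@ y = x @@ y + x' @@ y.
Proof. by have := leibPl 1 x x' y; rewrite !scale1r. Qed.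

Lemma lam_leib x y a : lam (x @@ y) a = lam x (lam y a) - lam y (lam x a).
Proof.
elim/extsq_ind: y => [|r y z yE zE|c d].
- by rewrite leib0r !lam0 linear0 subrr.
- rewrite leibPr !lamP yE zE [lam x (_ + _)]linearP scalerBr opprD.
  by rewrite addrACA.
- rewrite derextE /= lamD !lamE lam_der.
  by rewrite addrK.
Qed.

Lemma leibA x y z : x @@ (y @@ z) = (x @@ y) @@ z + y @@ (x @@ z).
Proof.
elim/extsq_ind: z => [|r z z' zE zE'|c d].
- by rewrite !leib0r addr0.
- by rewrite !leibPr zE zE' scalerDr addrACA.
- rewrite !derextE /= !leibDr !derextE /= !lam_leib wedgeBl wedgeBr.
  rewrite [RHS](AC ((2*2)*(2*2)) (((1*7)*(6*3))*((5*2)*(8*4)))).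
  by rewrite /= !subrr !addr0.
Qed.

(* [modquot X] divides by the span of [X]: [ang] is (T /\ T) / A(T /\ T) = <T, T> *)
Definition Asq : set (extsq T) := range (fun x => derext (lam x) x).

Definition ang : Type := modquot Asq.
HB.instance Definition _ := GRing.Lmodule.on ang.
Implicit Types X Y Z : ang.

Local Notation cls := (modcoset Asq : extsq T -> ang).

Definition angle a b : ang := modcoset Asq (wedge a b).

Lemma clsD x y : cls (x + y) = cls x + cls y.
Proof. by rewrite linearD. Qed.

Lemma cls_leibC x y : cls (x @@ y) = - cls (y @@ x).
Proof.
have sq z : cls (z @@ z) = 0 by apply: modcoset0; exists z.
apply/eqP; rewrite -subr_eq0 opprK; apply/eqP.
have := sq (x + y); rewrite leibDl !leibDr !clsD (sq x) (sq y).
by rewrite add0r addr0.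
Qed.

Lemma lspan_lam v : v \in lspan Asq -> forall a, lam v a = 0.
Proof.
move=> vA a; apply: (lspan_ker (f := fun v => lam v a)) vA => [r x y|_ [x _ <-]].
  exact: lamP.
by rewrite lam_leib subrr.
Qed.

Lemma lam0_leib v y : (forall a, lam v a = 0) -> v @@ y = 0.
Proof.
move=> v0; elim/extsq_ind: y => [|r y z yE zE|c d].
- exact: leib0r.
- by rewrite leibPr yE zE scaler0 addr0.
- by rewrite derextE /= !v0 -(subrr 0) wedgeBl wedgeBr !subrr addr0.
Qed.

Lemma lspan_leib x v : v \in lspan Asq -> cls (x @@ v) = 0.
Proof.
move=> vA; apply: (lspan_ker (f := fun v => cls (x @@ v))) vA => [r y z|_ [y _ <-]].
  by rewrite leibPr linearP.
by rewrite leibA clsD cls_leibC addNr.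
Qed.

(* the Lie product of <T, T> and the map mu, computed on representatives;
   see [ang_lie_angle] and [mu_angle] *)
Definition ang_lie X Y : ang := modcoset Asq (derext (lam (repr X)) (repr Y)).

Definition mu X : T -> T := lam (repr X).

Lemma repr_cls x : exists2 v, v \in lspan Asq & repr (cls x : modquot Asq) = x + v.
Proof.
exists (repr (cls x : modquot Asq) - x); last by rewrite addrC subrK.
by apply/modcoset_eqP; rewrite modcosetK.
Qed.

Lemma mu_cls x a : mu (cls x) a = lam x a.
Proof.
by have [v vA vE] := repr_cls x; rewrite /mu vE lamD (lspan_lam vA) addr0.
Qed.

Lemma ang_lie_cls x y : ang_lie (cls x) (cls y) = cls (x @@ y).
Proof.
rewrite /ang_lie; have [v vA ->] := repr_cls x; have [w wA ->] := repr_cls y.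
rewrite leibDl (lam0_leib _ (lspan_lam vA)) addr0 leibDr clsD.
by rewrite (lspan_leib _ wA) addr0.
Qed.

Lemma ang_ind (P : ang -> Prop) : (forall x, P (cls x)) -> forall X, P X.
Proof. by move=> Px X; rewrite -[X]modcosetK. Qed.

Lemma mu_angle a b c : mu (angle a b) c = [lts a, b, c].
Proof. by rewrite mu_cls lamE. Qed.

Lemma ang_lie_angle a b c d :
  ang_lie (angle a b) (angle c d)
  = angle [lts a, b, c] d + angle c [lts a, b, d].
Proof. by rewrite ang_lie_cls derextE /= lamE clsD. Qed.

Fact mu_linear X : linear (mu X). Proof. exact: lam_linear. Qed.
HB.instance Definition _ X := GRing.isLinear.Build k T T *:%R (mu X) (mu_linear X).

Lemma muP r X Y a : mu (r *: X + Y) a = r *: mu X a + mu Y a.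
Proof.
elim/ang_ind: X => x; elim/ang_ind: Y => y.
by rewrite -linearP !mu_cls lamP.
Qed.

Fact ang_lie_linearl Y : linear (ang_lie^~ Y).
Proof.
move=> r X X'; elim/ang_ind: X => x; elim/ang_ind: X' => x'.
elim/ang_ind: Y => y.
by rewrite -linearP !ang_lie_cls leibPl linearP.
Qed.

Fact ang_lie_linearr X : linear (ang_lie X).
Proof.
move=> r Y Y'; elim/ang_ind: X => x; elim/ang_ind: Y' => y'.
elim/ang_ind: Y => y.
by rewrite -linearP !ang_lie_cls leibPr linearP.
Qed.

Fact ang_liexx X : ang_lie X X = 0.
Proof.
by elim/ang_ind: X => x; rewrite ang_lie_cls; apply: modcoset0; exists x.
Qed.

Fact ang_lie_jacobi X Y Z :
  ang_lie X (ang_lie Y Z) + ang_lie Y (ang_lie Z X) + ang_lie Z (ang_lie X Y) = 0.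
Proof.
elim/ang_ind: X => x; elim/ang_ind: Y => y; elim/ang_ind: Z => z.
rewrite !ang_lie_cls leibA clsD [cls (z @@ _)]cls_leibC.
have -> : cls (y @@ (z @@ x)) = - cls (y @@ (x @@ z)).
  apply/eqP; rewrite -subr_eq0 opprK -clsD -leibDr lspan_leib //.
  rewrite -[x @@ z]opprK; apply/modcoset_eqP.
  by rewrite linearN; exact: cls_leibC.
by rewrite addrK subrr.
Qed.

HB.instance Definition _ := isLieAlgebra.Build k ang
  ang_lie_linearl ang_lie_linearr ang_liexx ang_lie_jacobi.

Lemma angle_linearl b : linear (angle^~ b).
Proof. by move=> r a a'; rewrite /angle wedge_linearl linearP. Qed.

Lemma angle_linearr a : linear (angle a).
Proof. by move=> r b b'; rewrite /angle wedge_linearr linearP. Qed.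

Lemma angleBr a b b' : angle a (b - b') = angle a b - angle a b'.
Proof. by rewrite /angle wedgeBr linearB. Qed.

Lemma anglexx a : angle a a = 0.
Proof. by rewrite /angle wedgexx linear0. Qed.

Lemma angleC a b : angle b a = - angle a b.
Proof. by rewrite /angle wedgeC linearN. Qed.

Lemma lie_angle X b c : [lie X, angle b c] = angle (mu X b) c + angle b (mu X c).
Proof.
elim/ang_ind: X => x.
by rewrite [LHS]ang_lie_cls derextE /= clsD !mu_cls.
Qed.

Lemma mu_lie X Y a : mu [lie X, Y] a = mu X (mu Y a) - mu Y (mu X a).
Proof.
elim/ang_ind: X => x; elim/ang_ind: Y => y.
by rewrite [lie _ _]ang_lie_cls !mu_cls lam_leib.
Qed.

Lemma muD X Y a : mu (X + Y) a = mu X a + mu Y a.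
Proof. by have := muP 1 X Y a; rewrite !scale1r. Qed.

#[global] Opaque mu angle ang_lie.

(* A(T) = <T, T> (+) T, the element X + a being the pair [(X, a)] *)
Definition stdenv : Type := (ang * T)%type.
HB.instance Definition _ := GRing.Lmodule.on stdenv.
Implicit Types u v w : stdenv.

Definition stdenv_lie u v : stdenv :=
  ([lie u.1, v.1] + angle u.2 v.2, mu u.1 v.2 - mu v.1 u.2).

Fact stdenv_lie_linearl v : linear (stdenv_lie^~ v).
Proof.
move=> r [X a] [X' a']; case: v => Y b; congr pair => /=.
  by rewrite lie_linearl angle_linearl scalerDr addrACA.
by rewrite muP mu_linear scalerBr opprD addrACA.
Qed.

Fact stdenv_lie_linearr u : linear (stdenv_lie u).
Proof.
move=> r [Y b] [Y' b']; case: u => X a; congr pair => /=.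
  by rewrite lie_linearr angle_linearr scalerDr addrACA.
by rewrite muP mu_linear scalerBr opprD addrACA.
Qed.

Fact stdenv_liexx u : stdenv_lie u u = 0.
Proof. by rewrite /stdenv_lie liexx anglexx subrr addr0. Qed.

Fact stdenv_lie_jacobi u v w :
  stdenv_lie u (stdenv_lie v w) + stdenv_lie v (stdenv_lie w u)
  + stdenv_lie w (stdenv_lie u v) = 0.
Proof.
case: u v w => [X a] [Y b] [Z c]; congr pair => /=.
  rewrite !linearD /= !lie_angle !angleBr.
  rewrite [angle (mu X b) c]angleC [angle (mu Y c) a]angleC.
  rewrite [angle (mu Z a) b]angleC.
  rewrite (AC (((1*2*2)*(1*2*2))*(1*2*2))
    ((1*6*11)*((14*2)*(3*10)*(4*7)*(13*5)*(8*15)*(9*12)))) /=.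
  by rewrite !subrr !addr0 lie_jacobi.
rewrite !muD !mu_lie !mu_angle !linearB /= !opprD !opprK.
rewrite (AC (((2*3)*(2*3))*(2*3))
  ((5*10*15)*((1*13)*(9*2)*(6*3)*(4*12)*(14*7)*(11*8)))) /=.
by rewrite !subrr !addr0 -!opprD [X in - X](AC 3 (3*1*2)) /= lts_cyclic oppr0.
Qed.

HB.instance Definition _ := isLieAlgebra.Build k stdenv
  stdenv_lie_linearl stdenv_lie_linearr stdenv_liexx stdenv_lie_jacobi.

Definition iota_std a : stdenv := (0, a).

End Standard.

(* Main.v *)
(** An imbedding [e : T -> L] must send [a /\ b] to [[e a, e b]]. This map [psi]
    on [T /\ T] turns the action of [lambda x] into the adjoint action of
    [psi x], so it kills [lambda x . x], and descends to [<T, T>].  The induced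
    map plus [e] is the required morphism; it is unique because
    [<a, b> = [iota a, iota b]], so that [iota T] generates [A(T)]. *)
From HB Require Import structures.
Require Import Defs.
From mathcomp Require Import all_boot all_algebra.
From mathcomp Require Import boolp.

Set Implicit Arguments.
Unset Strict Implicit.
Unset Printing Implicit Defensive.

Import GRing.Theory.
Local Open Scope ring_scope.

Section LieTheory.
Variables (k : comPzRingType) (L : lieAlgType k).
Implicit Types x y z : L.

Lemma lieDl x x' y : [lie x + x', y] = [lie x, y] + [lie x', y].
Proof. by have := lie_linearl y 1 x x'; rewrite !scale1r. Qed.

Lemma lie0l y : [lie 0, y] = 0.
Proof. by apply: (addrI [lie 0, y]); rewrite -lieDl !addr0. Qed.

Lemma lieC x y : [lie x, y] = - [lie y, x].
Proof.
apply/eqP; rewrite -addr_eq0; apply/eqP.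
by have := liexx (x + y); rewrite lieDl !linearD /= !liexx add0r addr0.
Qed.

(** The Jacobi identity in derivation form, matching the way [derext] acts on a wedge. *)
Lemma lie_ad x y z : [lie x, [lie y, z]] = [lie [lie x, y], z] + [lie y, [lie x, z]].
Proof.
have /eqP := lie_jacobi x y z.
by rewrite -addrA addr_eq0 (lieC z x) linearN /= (lieC z) opprD !opprK addrC => /eqP.
Qed.

End LieTheory.

Section StandardEnvelope.
Variables (k : comPzRingType) (T : lieTripleType k).
Implicit Types (a b c : T) (X Y : ang T).

#[local] Transparent angle.
(** Unfolds the opaque [angle] once, so that [psi_cls] can be applied to it. *)
Lemma angle_coset a b : angle a b = modcoset (@Asq k T) (wedge a b).
Proof. by []. Qed.
#[local] Opaque angle.

Lemma mu0 a : mu (0 : ang T) a = 0.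
Proof. by apply: (addrI (mu 0 a)); rewrite -muD !addr0. Qed.

Lemma angle0l b : angle 0 b = 0 :> ang T.
Proof. by rewrite angleC (_ : angle b 0 = 0) ?oppr0 // -(subrr 0) angleBr subrr. Qed.

Lemma stdenv_lieE (u v : stdenv T) :
  [lie u, v] = ([lie u.1, v.1] + angle u.2 v.2, mu u.1 v.2 - mu v.1 u.2).
Proof. by []. Qed.

Lemma lie_iota a b : [lie iota_std a, iota_std b] = (angle a b, 0) :> stdenv T.
Proof. by rewrite stdenv_lieE /= !mu0 subrr liexx add0r. Qed.

Lemma iota_imbedding : imbedding (@iota_std k T).
Proof.
split=> [r a b|a b c].
  by congr pair; rewrite /= scaler0 addr0.
(* Bracketing [(angle a b, 0)] with [(0, c)] leaves only [mu (angle a b) c] in the second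
   component. *)
by rewrite lie_iota stdenv_lieE /= linear0 angle0l mu_angle mu0 subr0 addr0.
Qed.

End StandardEnvelope.

Section Extension.
Variables (k : comPzRingType) (T : lieTripleType k) (L : lieAlgType k).
Variable e : T -> L.
Hypothesis e_imb : imbedding e.
Implicit Types (a b c : T) (x y : extsq T) (X Y : ang T) (u v : stdenv T).

Let e_lin : linear e := proj1 e_imb.
HB.instance Definition _ := GRing.isLinear.Build k T L *:%R e e_lin.

Lemma imbedding_alternating : alternating (fun a b => [lie e a, e b]).
Proof.
split=> [b r a a'|a r b b'|a]; last exact: liexx.
- by rewrite linearP lie_linearl.
- by rewrite !linearP.
Qed.

Definition psi_ext : extsq T -> L := ext_lift (fun a b => [lie e a, e b]).

HB.instance Definition _ := GRing.isLinear.Build k (extsq T) L *:%R psi_ext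
  (ext_lift_linear imbedding_alternating).

Lemma psi_ext_wedge a b : psi_ext (wedge a b) = [lie e a, e b].
Proof. exact: ext_liftE imbedding_alternating. Qed.

(** Both sides are linear in [x], and on wedges this is the imbedding identity of [e]. *)
Lemma psi_ext_lam x c : [lie psi_ext x, e c] = e (lam x c).
Proof.
elim/extsq_ind: x => [|r x y xE yE|a b].
- by rewrite lam0 !linear0 lie0l.
- by rewrite lamP !linearP lie_linearl xE yE.
- by rewrite psi_ext_wedge lamE e_imb.2.
Qed.

(** For [y] a wedge, [ad (psi_ext x)] and [derext (lam x)] both obey the Leibniz rule, and
    [psi_ext_lam] matches them on each factor. *)
Lemma psi_ext_leib x y : psi_ext (derext (lam x) y) = [lie psi_ext x, psi_ext y].
Proof.
elim/extsq_ind: y => [|r y z yE zE|c d].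
- by rewrite !linear0.
- by rewrite leibPr !linearP /= yE zE.
- by rewrite derextE linearD /= !psi_ext_wedge lie_ad !psi_ext_lam.
Qed.

Lemma psi_ext_lspan x : x \in lspan (@Asq k T) -> psi_ext x = 0.
Proof.
apply: lspan_ker => [|_ [y _ <-]]; first exact: linearP.
by rewrite psi_ext_leib liexx.
Qed.

(** Independence of the representative is [psi_cls]. *)
Definition psi X : L := psi_ext (repr X).

Lemma psi_cls x : psi (modcoset (@Asq k T) x) = psi_ext x.
Proof.
by have [v vA vE] := repr_cls x; rewrite /psi vE linearD /= (psi_ext_lspan vA) addr0.
Qed.

Fact psi_linear : linear psi.
Proof.
move=> r X Y; elim/ang_ind: X => x; elim/ang_ind: Y => y.
by rewrite -linearP !psi_cls linearP.
Qed.
HB.instance Definition _ := GRing.isLinear.Build k (ang T) L *:%R psi psi_linear.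

Lemma psi_angle a b : psi (angle a b) = [lie e a, e b].
Proof. by rewrite angle_coset psi_cls psi_ext_wedge. Qed.

Lemma psi_mu X c : [lie psi X, e c] = e (mu X c).
Proof. by elim/ang_ind: X => x; rewrite psi_cls mu_cls psi_ext_lam. Qed.

Lemma psi_lie X Y : psi [lie X, Y] = [lie psi X, psi Y].
Proof.
elim/ang_ind: X => x; elim/ang_ind: Y => y.
by rewrite [lie _ _ in LHS]ang_lie_cls !psi_cls psi_ext_leib.
Qed.

Definition stdenv_ext u : L := psi u.1 + e u.2.

Lemma stdenv_ext_hom : lie_hom stdenv_ext.
Proof.
split=> [r u v|u v].
  by rewrite /stdenv_ext /= !linearP scalerDr addrACA.
rewrite stdenv_lieE /stdenv_ext /= linearD linearB /= psi_lie psi_angle -!psi_mu.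
(* Antisymmetry of the mixed bracket yields the minus sign of [mu v.1 u.2]; the rest is
   reordering. *)
rewrite lieDl !linearD /= [[lie e u.2, psi v.1]]lieC -!addrA; congr (_ + _).
by rewrite addrC -addrA; congr (_ + _); rewrite addrC.
Qed.

Lemma stdenv_ext_iota : stdenv_ext \o @iota_std k T = e.
Proof. by apply/funext => a; rewrite /= /stdenv_ext linear0 add0r. Qed.

Lemma stdenv_ext_unique (f : stdenv T -> L) :
  lie_hom f -> f \o @iota_std k T = e -> stdenv_ext = f.
Proof.
move=> [f_lin f_lie] fe; have {}fe a : f (iota_std a) = e a by rewrite -fe.
(* Packing [f] as a linear map [g] makes the generic linearity lemmas available. *)
pose F := GRing.isLinear.Build k (stdenv T) L *:%R f f_lin.
pose g : {linear stdenv T -> L} := HB.pack f F.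
have f_angle a b : f (angle a b, 0) = [lie e a, e b].
  by rewrite -lie_iota f_lie !fe.
have f_psi X : f (X, 0) = psi X.
  elim/ang_ind: X => x; rewrite psi_cls.
  elim/extsq_ind: x => [|r x y xE yE|a b].
  - by rewrite !linear0; exact: (linear0 g).
  - rewrite !linearP /= -xE -yE -f_lin; congr f; congr pair.
    by rewrite /= scaler0 addr0.
  - by rewrite -angle_coset f_angle psi_ext_wedge.
(* It remains to split [(X, a)] as [(X, 0) + (0, a)]. *)
apply/funext => -[X a]; rewrite /stdenv_ext /= -f_psi -fe.
by rewrite -(linearD g); congr f; congr pair; rewrite /= ?addr0 ?add0r.
Qed.

End Extension.

Theorem theorem3p5 (k : comPzRingType) (T : lieTripleType k) :
  universal_imbedding (@iota_std k T).
Proof.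
split; first exact: iota_imbedding.
move=> L e e_imb; exists (stdenv_ext e); split.
  by split; [exact: stdenv_ext_hom|exact: stdenv_ext_iota].
by move=> f [f_hom fe]; exact: stdenv_ext_unique.
Qed.
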